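(* Let $R$ be a commutative unitary ring and let $\mathcal{C}$ be a category with a distinguished subcategory and with an initial object $0$ such that $0\to X$ is distinguished for all $X\in\mathcal{C}$. Let $H:\mathcal{C}^\square\to\mathcal{A}_\partial(\mathcal{C})$ be the universal relative homology and set $H_i(X):=H_i(X,0)$. Then the category $\mathcal{A}_\partial(\mathcal{C})$ coincides with its smallest abelian subcategory which contains the kernels and cokernels of morphisms between objects $H_i(X)$, for $X\in\mathcal{C}$ and $i\in\mathbb{Z}$, and is closed under extensions of these (i.e. contains all extensions of such kernels and cokernels). In particular, every object of $\mathcal{A}_\partial(\mathcal{C})$ is obtained by (finitely many successive) extensions from sub-quotients of objects $H_i(X)$ for $X\in\mathcal{C}$ and $i\in\mathbb{Z}$.
   Context: Size: everything is relative to a fixed universe; $\mathcal{C}$ is small. $\mathsf{Ex}_R$ is the 2-category of (essentially small) $R$-linear abelian categories, $R$-linear exact functors and natural transformations. Morphisms of the distinguished subcategory are called distinguished. The category of pairs $\mathcal{C}^\square$ has as objects the distinguished morphisms $f:Y\to X$, denoted $(X,Y)$ (so $(X,0)$ is the morphism $0\to X$); a morphism $(X,Y)\to(X',Y')$ is a pair $(h,k)$ of morphisms $h:X\to X'$, $k:Y\to Y'$ of $\mathcal{C}$ with $hf=f'k$. Distinguished $f:Z\to Y$, $g:Y\to X$ define a triple $(X,Y),(X,Z),(Y,Z)$ with $\alpha=(g,\mathrm{id}_Z):(Y,Z)\to(X,Z)$ and $\beta=(\mathrm{id}_X,f):(X,Z)\to(X,Y)$. A $\partial$-cube is a commutative square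 given by $\gamma:(Y,Z)\to(Y',Z')$ and $\delta:(X,Y)\to(X',Y')$ with $\delta\beta\alpha=\beta'\alpha'\gamma$, for two triples. A relative homology on $\mathcal{C}^\square$ with values in an $R$-linear abelian category $\mathcal{A}$ is a family of functors $H_i:\mathcal{C}^\square\to\mathcal{A}$, $i\in\mathbb{Z}$, with morphisms $\partial_i:H_i(X,Y)\to H_{i-1}(Y,Z)$ for each triple, such that for each triple $\cdots\to H_i(Y,Z)\xrightarrow{\alpha_i}H_i(X,Z)\xrightarrow{\beta_i}H_i(X,Y)\xrightarrow{\partial_i}H_{i-1}(Y,Z)\to\cdots$ is exact, and for each $\partial$-cube $\gamma_{i-1}\partial_i=\partial_i'\delta_i$. Morphisms are families of natural transformations commuting with the $\partial_i$. This gives the category $\underline{\mathsf{Hom}}(\mathcal{C}^\square,\mathcal{A})$, a 2-functor of $\mathcal{A}\in\mathsf{Ex}_R$ by composition. The universal relative homology is the pair $(\mathcal{A}_\partial(\mathcal{C}),H)$ representing it (it exists): $G\mapsto GH$ is an equivalence $\mathsf{Ex}_R(\mathcal{A}_\partial(\mathcal{C}),\mathcal{A})\cong\underline{\mathsf{Hom}}(\mathcal{C}^\square,\mathcal{A})$ natural in $\mathcal{A}$. An abelian subcategory means a full subcategory, closed under isomorphism, that is abelian with exact inclusion. *)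

(* Defs.v *)
(* MathComp world. *)
From HB Require Import structures.
From mathcomp Require Import all_boot all_order all_algebra.
From mathcomp Require Import boolp.

Set Implicit Arguments.
Unset Strict Implicit.
Unset Printing Implicit Defensive.

Import GRing.Theory.
Local Open Scope ring_scope.

Local Obligation Tactic := idtac.

Record category := Category {
  obj :> Type;
  hom : obj -> obj -> Type;
  idm : forall X, hom X X;
  comp : forall X Y Z, hom Y Z -> hom X Y -> hom X Z;
  comp_idl : forall X Y (f : hom X Y), comp (idm Y) f = f;
  comp_idr : forall X Y (f : hom X Y), comp f (idm X) = f;
  compA : forall X Y Z W (h : hom Z W) (g : hom Y Z) (f : hom X Y),
    comp h (comp g f) = comp (comp h g) f
}.

Arguments idm {c} X.

Notation "g \oc f" := (comp g f) (at level 40, left associativity).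

Section Basics.
Variable C : category.

Definition mono (X Y : C) (f : hom X Y) : Prop :=
  forall W (u v : hom W X), f \oc u = f \oc v -> u = v.

Definition epi (X Y : C) (f : hom X Y) : Prop :=
  forall W (u v : hom Y W), u \oc f = v \oc f -> u = v.

Definition isomorphic (X Y : C) : Prop :=
  exists (f : hom X Y) (g : hom Y X), g \oc f = idm X /\ f \oc g = idm Y.

Record initial_object := InitialObject {
  init :> C;
  from_init : forall X, hom init X;
  from_init_uniq : forall X (f : hom init X), f = from_init X
}.

Record subcategory := Subcategory {
  sub_obj : C -> Prop;
  sub_mor : forall X Y, hom X Y -> Prop;
  sub_dom : forall X Y (f : hom X Y), sub_mor f -> sub_obj X;
  sub_cod : forall X Y (f : hom X Y), sub_mor f -> sub_obj Y;
  sub_idm : forall X, sub_obj X -> sub_mor (idm X);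
  sub_comp : forall X Y Z (g : hom Y Z) (f : hom X Y),
    sub_mor g -> sub_mor f -> sub_mor (g \oc f)
}.

End Basics.

Record functor (C D : category) := Functor {
  fobj :> C -> D;
  fmap : forall X Y, hom X Y -> hom (fobj X) (fobj Y);
  fmap_idm : forall X, fmap (idm X) = idm (fobj X);
  fmap_comp : forall X Y Z (g : hom Y Z) (f : hom X Y),
    fmap (g \oc f) = fmap g \oc fmap f
}.

Record nat_trans (C D : category) (F G : functor C D) := NatTrans {
  ncomp :> forall X, hom (F X) (G X);
  naturality : forall X Y (f : hom X Y),
    ncomp Y \oc fmap F f = fmap G f \oc ncomp X
}.

Lemma nat_trans_eq (C D : category) (F G : functor C D) (s t : nat_trans F G) :
  (forall X, s X = t X) -> s = t.
Proof.
case: s t => [s sn] [t tn] /= st.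
have est : s = t by apply: functional_extensionality_dep.
by subst t; congr NatTrans; apply: Prop_irrelevance.
Qed.

Program Definition id_nat C D (F : functor C D) : nat_trans F F :=
  @NatTrans _ _ _ _ (fun X => idm (F X)) _.
Next Obligation. by move=> *; rewrite comp_idl comp_idr. Qed.

Program Definition comp_nat C D (F G K : functor C D)
    (t : nat_trans G K) (s : nat_trans F G) : nat_trans F K :=
  @NatTrans _ _ _ _ (fun X => t X \oc s X) _.
Next Obligation.
by move=> *; rewrite -compA naturality compA naturality compA.
Qed.

Program Definition functor_cat (C D : category) : category :=
  @Category (functor C D) (@nat_trans C D) (@id_nat C D) (@comp_nat C D) _ _ _.
Next Obligation. by move=> *; apply: nat_trans_eq => W; apply: comp_idl. Qed.
Next Obligation. by move=> *; apply: nat_trans_eq => W; apply: comp_idr. Qed.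
Next Obligation. by move=> *; apply: nat_trans_eq => U; apply: compA. Qed.

Program Definition id_functor (C : category) : functor C C :=
  @Functor C C id (fun _ _ f => f) _ _.
Next Obligation. by []. Qed.
Next Obligation. by []. Qed.

Program Definition comp_functor (C D E : category)
    (G : functor D E) (F : functor C D) : functor C E :=
  @Functor C E (fun X => G (F X)) (fun _ _ f => fmap G (fmap F f)) _ _.
Next Obligation. by move=> * /=; rewrite !fmap_idm. Qed.
Next Obligation. by move=> * /=; rewrite !fmap_comp. Qed.

Definition is_equivalence (C D : category) (F : functor C D) : Prop :=
  exists G : functor D C,
    isomorphic (C := functor_cat C C) (comp_functor G F) (id_functor C) /\
    isomorphic (C := functor_cat D D) (comp_functor F G) (id_functor D).

(* The fixed universe of small types; [category] may have its objects and
   morphisms in a larger one. *)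
Definition universe := Type.

Definition small_type (T : Type) : Prop :=
  exists (I : universe) (e : I -> T), bijective e.

Definition small_category (C : category) : Prop :=
  small_type C /\ forall X Y : C, small_type (hom X Y).

Definition essentially_small (C : category) : Prop :=
  exists2 D : category, small_category D &
    exists F : functor D C, is_equivalence F.

Record lincat (R : comPzRingType) := LinCat {
  base :> category;
  hom_lmod : forall X Y : base, GRing.Lmodule R (hom X Y);
  comp_linl : forall (X Y Z : base) (f : hom X Y),
    let V X Y : lmodType R := GRing.Lmodule.Pack (hom_lmod X Y) in
    linear ((fun g => g \oc f) : V Y Z -> V X Z);
  comp_linr : forall (X Y Z : base) (g : hom Y Z),
    let V X Y : lmodType R := GRing.Lmodule.Pack (hom_lmod X Y) in
    linear ((fun f => g \oc f) : V X Y -> V X Z)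
}.

HB.instance Definition _ (R : comPzRingType) (A : lincat R) (X Y : A) :=
  hom_lmod X Y.


Section Abelian.
Variables (R : comPzRingType) (A : lincat R).

Definition is_zero_object (Z : A) : Prop := idm Z = 0.

Definition is_biproduct (X Y P : A) : Prop :=
  exists (i1 : hom X P) (i2 : hom Y P) (p1 : hom P X) (p2 : hom P Y),
    [/\ p1 \oc i1 = idm X, p2 \oc i2 = idm Y, p1 \oc i2 = 0, p2 \oc i1 = 0
      & i1 \oc p1 + i2 \oc p2 = idm P].

Definition is_kernel (X Y K : A) (f : hom X Y) (k : hom K X) : Prop :=
  f \oc k = 0 /\
  forall W (g : hom W X), f \oc g = 0 -> exists! u : hom W K, k \oc u = g.

Definition is_cokernel (X Y Q : A) (f : hom X Y) (q : hom Y Q) : Prop :=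
  q \oc f = 0 /\
  forall W (g : hom Y W), g \oc f = 0 -> exists! u : hom Q W, u \oc q = g.

Record is_abelian : Prop := IsAbelian {
  has_zero_object : exists Z, is_zero_object Z;
  has_biproducts : forall X Y : A, exists P, is_biproduct X Y P;
  has_kernels : forall (X Y : A) (f : hom X Y),
    exists K (k : hom K X), is_kernel f k;
  has_cokernels : forall (X Y : A) (f : hom X Y),
    exists Q (q : hom Y Q), is_cokernel f q;
  mono_normal : forall (X Y : A) (m : hom X Y), mono m ->
    exists Z (f : hom Y Z), is_kernel f m;
  epi_normal : forall (X Y : A) (e : hom X Y), epi e ->
    exists Z (f : hom Z X), is_cokernel f e
}.

(* The image of [f], as the kernel of a cokernel of [f]. *)
Definition is_image (X Y I : A) (f : hom X Y) (m : hom I Y) : Prop :=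
  exists Q (q : hom Y Q), is_cokernel f q /\ is_kernel q m.

Definition exact (X Y Z : A) (f : hom X Y) (g : hom Y Z) : Prop :=
  exists I (m : hom I Y), is_image f m /\ is_kernel g m.

Definition short_exact (X Y Z : A) (f : hom X Y) (g : hom Y Z) : Prop :=
  is_kernel g f /\ is_cokernel f g.

Definition is_extension (K L E : A) : Prop :=
  exists (f : hom K E) (g : hom E L), short_exact f g.

Definition is_subquotient (M Q : A) : Prop :=
  exists N (m : hom N M) (e : hom N Q), mono m /\ epi e.

(* Objects obtained from those in [P] by finitely many successive
   extensions. *)
Inductive iterated_extension (P : A -> Prop) : A -> Prop :=
| iext_base X : P X -> iterated_extension P X
| iext_step K L E : iterated_extension P K -> iterated_extension P L ->
    is_extension K L E -> iterated_extension P E.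

Program Definition full_subcat (S : A -> Prop) : category :=
  @Category {X : A | S X} (fun X Y => hom (sval X) (sval Y))
    (fun X => idm (sval X)) (fun X Y Z g f => g \oc f) _ _ _.
Next Obligation. by move=> *; apply: comp_idl. Qed.
Next Obligation. by move=> *; apply: comp_idr. Qed.
Next Obligation. by move=> *; apply: compA. Qed.

Program Definition full_sublincat (S : A -> Prop) : lincat R :=
  @LinCat R (full_subcat S) (fun X Y => hom_lmod (sval X) (sval Y)) _ _.
Next Obligation. by move=> S X Y Z f; apply: comp_linl. Qed.
Next Obligation. by move=> S X Y Z g; apply: comp_linr. Qed.

Program Definition inclusion (S : A -> Prop) : functor (full_sublincat S) A :=
  @Functor (full_sublincat S) A sval (fun _ _ f => f) _ _.
Next Obligation. by []. Qed.
Next Obligation. by []. Qed.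

End Abelian.

Section ExactFunctors.
Variable R : comPzRingType.

Definition linear_functor (A B : lincat R) (F : functor A B) : Prop :=
  forall X Y : A, linear (@fmap A B F X Y : hom X Y -> hom (F X) (F Y)).

Definition exact_functor (A B : lincat R) (F : functor A B) : Prop :=
  linear_functor F /\
  forall (X Y Z : A) (f : hom X Y) (g : hom Y Z),
    exact f g -> exact (fmap F f) (fmap F g).

Definition abelian_subcategory (A : lincat R) (S : A -> Prop) : Prop :=
  [/\ forall X Y, isomorphic X Y -> S X -> S Y,
      is_abelian (full_sublincat S)
    & exact_functor (inclusion S)].

(* The objects of the 2-category of essentially small abelian categories, and
   its hom-categories. *)
Record Ex := ExObj {
  ex_lincat :> lincat R;
  ex_abelian : is_abelian ex_lincat;
  ex_small : essentially_small ex_lincat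
}.

Record exfun (A B : lincat R) := ExFun {
  exfun_functor :> functor A B;
  exfun_exact : exact_functor exfun_functor
}.

Program Definition Ex_hom (A B : lincat R) : category :=
  @Category (exfun A B) (fun F G => nat_trans F G)
    (fun F => id_nat F) (fun F G K t s => comp_nat t s) _ _ _.
Next Obligation. by move=> *; apply: (comp_idl (c := functor_cat _ _)). Qed.
Next Obligation. by move=> *; apply: (comp_idr (c := functor_cat _ _)). Qed.
Next Obligation. by move=> *; apply: (compA (c := functor_cat _ _)). Qed.

End ExactFunctors.

Section Pairs.
Variables (C : category) (D : subcategory C).

(* [Pair f] with [f : Y -> X] is the object written (X, Y). *)
Record pair_obj := Pair {
  pair_X : C;
  pair_Y : C;
  pair_mor : hom pair_Y pair_X;
  pair_dist : sub_mor D pair_mor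
}.

Record pair_hom (P Q : pair_obj) := PairHom {
  ph_X : hom (pair_X P) (pair_X Q);
  ph_Y : hom (pair_Y P) (pair_Y Q);
  ph_comm : ph_X \oc pair_mor P = pair_mor Q \oc ph_Y
}.

Lemma pair_hom_eq (P Q : pair_obj) (u v : pair_hom P Q) :
  ph_X u = ph_X v -> ph_Y u = ph_Y v -> u = v.
Proof.
case: u v => [h k c] [h' k' c'] /= eh ek; subst h' k'.
by congr PairHom; apply: Prop_irrelevance.
Qed.

Program Definition pair_id (P : pair_obj) : pair_hom P P :=
  @PairHom P P (idm _) (idm _) _.
Next Obligation. by move=> P; rewrite comp_idl comp_idr. Qed.

Program Definition pair_comp (P Q S : pair_obj)
    (v : pair_hom Q S) (u : pair_hom P Q) : pair_hom P S :=
  @PairHom P S (ph_X v \oc ph_X u) (ph_Y v \oc ph_Y u) _.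
Next Obligation.
by move=> P Q S v u; rewrite -compA ph_comm compA ph_comm compA.
Qed.

Program Definition pairs : category :=
  @Category pair_obj pair_hom pair_id pair_comp _ _ _.
Next Obligation. by move=> *; apply: pair_hom_eq; apply: comp_idl. Qed.
Next Obligation. by move=> *; apply: pair_hom_eq; apply: comp_idr. Qed.
Next Obligation. by move=> *; apply: pair_hom_eq; apply: compA. Qed.

(* Distinguished [f : Z -> Y] and [g : Y -> X], giving the pairs
   (X, Y) = g, (X, Z) = g f and (Y, Z) = f. *)
Record triple := Triple {
  tr_X : C;
  tr_Y : C;
  tr_Z : C;
  tr_f : hom tr_Z tr_Y;
  tr_g : hom tr_Y tr_X;
  tr_f_dist : sub_mor D tr_f;
  tr_g_dist : sub_mor D tr_g
}.

Definition tr_XY (t : triple) : pairs := Pair (tr_g_dist t).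
Definition tr_YZ (t : triple) : pairs := Pair (tr_f_dist t).
Definition tr_XZ (t : triple) : pairs :=
  Pair (sub_comp (tr_g_dist t) (tr_f_dist t)).

Program Definition alpha (t : triple) : hom (tr_YZ t) (tr_XZ t) :=
  @PairHom (tr_YZ t) (tr_XZ t) (tr_g t) (idm (tr_Z t)) _.
Next Obligation. by move=> t /=; rewrite comp_idr. Qed.

Program Definition beta (t : triple) : hom (tr_XZ t) (tr_XY t) :=
  @PairHom (tr_XZ t) (tr_XY t) (idm (tr_X t)) (tr_f t) _.
Next Obligation. by move=> t /=; rewrite comp_idl. Qed.

Definition boundary_cube (t t' : triple) (gamma : hom (tr_YZ t) (tr_YZ t'))
    (delta : hom (tr_XY t) (tr_XY t')) : Prop :=
  delta \oc (beta t \oc alpha t) = (beta t' \oc alpha t') \oc gamma.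

Section RelativeHomology.
Variable R : comPzRingType.

Record relhom (A : lincat R) := RelHom {
  rh_functor :> int -> functor pairs A;
  rh_bd : forall (i : int) (t : triple),
    hom (rh_functor i (tr_XY t)) (rh_functor (i - 1) (tr_YZ t));
  rh_exact_alpha_beta : forall (i : int) (t : triple),
    exact (fmap (rh_functor i) (alpha t)) (fmap (rh_functor i) (beta t));
  rh_exact_beta_bd : forall (i : int) (t : triple),
    exact (fmap (rh_functor i) (beta t)) (rh_bd i t);
  rh_exact_bd_alpha : forall (i : int) (t : triple),
    exact (rh_bd i t) (fmap (rh_functor (i - 1)) (alpha t));
  rh_cube : forall (i : int) (t t' : triple) (gamma : hom (tr_YZ t) (tr_YZ t'))
      (delta : hom (tr_XY t) (tr_XY t')), boundary_cube gamma delta ->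
    fmap (rh_functor (i - 1)) gamma \oc rh_bd i t =
    rh_bd i t' \oc fmap (rh_functor i) delta
}.

Record relhom_mor (A : lincat R) (H K : relhom A) := RelHomMor {
  rm_nat :> forall i, nat_trans (H i) (K i);
  rm_bd : forall (i : int) (t : triple),
    rm_nat (i - 1) (tr_YZ t) \oc rh_bd H i t =
    rh_bd K i t \oc rm_nat i (tr_XY t)
}.

Lemma relhom_mor_eq (A : lincat R) (H K : relhom A) (s t : relhom_mor H K) :
  (forall i P, s i P = t i P) -> s = t.
Proof.
case: s t => [s sb] [t tb] /= st.
have est : s = t.
  by apply: functional_extensionality_dep => i; apply: nat_trans_eq.
by subst t; congr RelHomMor; apply: Prop_irrelevance.
Qed.

Program Definition relhom_id (A : lincat R) (H : relhom A) : relhom_mor H H :=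
  @RelHomMor A H H (fun i => id_nat (H i)) _.
Next Obligation. by move=> A H i t /=; rewrite comp_idl comp_idr. Qed.

Program Definition relhom_comp (A : lincat R) (H K L : relhom A)
    (t : relhom_mor K L) (s : relhom_mor H K) : relhom_mor H L :=
  @RelHomMor A H L (fun i => comp_nat (t i) (s i)) _.
Next Obligation.
by move=> A H K L t s i w /=; rewrite -compA (rm_bd s) !compA (rm_bd t).
Qed.

Program Definition relhom_cat (A : lincat R) : category :=
  @Category (relhom A) (@relhom_mor A) (@relhom_id A) (@relhom_comp A) _ _ _.
Next Obligation. by move=> *; apply: relhom_mor_eq => *; apply: comp_idl. Qed.
Next Obligation. by move=> *; apply: relhom_mor_eq => *; apply: comp_idr. Qed.
Next Obligation. by move=> *; apply: relhom_mor_eq => *; apply: compA. Qed.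

Section Composition.
Variables (A B : lincat R) (H : relhom A).

Program Definition relhom_push (G : exfun A B) : relhom B :=
  @RelHom B (fun i => comp_functor G (H i))
    (fun i t => fmap G (rh_bd H i t)) _ _ _ _.
Next Obligation.
by move=> G i t; apply: (exfun_exact G).2; apply: rh_exact_alpha_beta.
Qed.
Next Obligation.
by move=> G i t; apply: (exfun_exact G).2; apply: rh_exact_beta_bd.
Qed.
Next Obligation.
by move=> G i t; apply: (exfun_exact G).2; apply: rh_exact_bd_alpha.
Qed.
Next Obligation.
by move=> G i t t' gamma delta /(rh_cube H i) c; rewrite /= -!fmap_comp c.
Qed.

Program Definition whisker (P Q : category) (F : functor P Q)
    (E : category) (G G' : functor Q E) (s : nat_trans G G') :
    nat_trans (comp_functor G F) (comp_functor G' F) :=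
  @NatTrans _ _ (comp_functor G F) (comp_functor G' F) (fun X => s (F X)) _.
Next Obligation. by move=> P Q F E G G' s X Y f /=; rewrite naturality. Qed.

Program Definition relhom_push_mor (G G' : exfun A B) (s : nat_trans G G') :
    relhom_mor (relhom_push G) (relhom_push G') :=
  @RelHomMor B (relhom_push G) (relhom_push G') (fun i => whisker (H i) s) _.
Next Obligation. by move=> G G' s i t /=; rewrite naturality. Qed.

(* G |-> G H *)
Program Definition precomp : functor (Ex_hom A B) (relhom_cat B) :=
  @Functor (Ex_hom A B) (relhom_cat B) relhom_push relhom_push_mor _ _.
Next Obligation. by move=> G; apply: relhom_mor_eq. Qed.
Next Obligation. by move=> *; apply: relhom_mor_eq. Qed.

End Composition.

Definition universal (A : Ex R) (H : relhom A) : Prop :=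
  forall B : Ex R, is_equivalence (precomp B H).

End RelativeHomology.
End Pairs.

Section Absolute.
Variables (C : category) (D : subcategory C) (O : initial_object C).
Variable O_dist : forall X, sub_mor D (from_init O X).
Variables (R : comPzRingType) (A : lincat R) (H : relhom D A).

Definition abs_pair (X : C) : pairs D := Pair (O_dist X).

(* H_i(X) = H_i(X, 0) *)
Definition abs_hom (i : int) (X : C) : A := H i (abs_pair X).

(* Here the morphisms are arbitrary ones of [A], not only those induced by
   [C], and the two degrees may differ. *)
Definition ker_or_coker (K : A) : Prop :=
  exists (i j : int) (X Y : C) (f : hom (abs_hom i X) (abs_hom j Y)),
    (exists k : hom K (abs_hom i X), is_kernel f k) \/
    (exists q : hom (abs_hom j Y) K, is_cokernel f q).

Definition contains_ker_coker_ext (S : A -> Prop) : Prop :=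
  (forall K, ker_or_coker K -> S K) /\
  (forall K L E, ker_or_coker K -> ker_or_coker L -> is_extension K L E -> S E).

Definition abs_subquotient (Q : A) : Prop :=
  exists i X, is_subquotient (abs_hom i X) Q.

End Absolute.

Definition is_smallest (T : Type) (F : (T -> Prop) -> Prop) (S : T -> Prop) :
    Prop :=
  F S /\ forall S' : T -> Prop, F S' -> forall X, S X -> S' X.

(* Main.v *)
(* Let S be an abelian subcategory containing all H_i(X, Y).  Then H
   corestricts to S, and universality yields an exact G from A_d(C) to S with
   G H isomorphic to the corestriction; by universality again, G followed by the
   inclusion is isomorphic to the identity, so S is everything.  The exact
   sequence of the triple (X, Y), (X, 0), (Y, 0) exhibits H_i(X, Y) as an
   extension of a kernel by a cokernel of maps between absolute homologies, so
   this applies to every S of the theorem.  It also applies to the iterated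
   extensions of subquotients of the H_i(X), because these are closed under
   subobjects, quotients and extensions. *)

Require Import Defs.
From mathcomp Require Import all_boot all_order all_algebra.
From mathcomp Require Import boolp.
(* [compA] must be the associativity of Defs, not the one of ssrfun. *)
Import Defs.

Set Implicit Arguments.
Unset Strict Implicit.
Unset Printing Implicit Defensive.

Import GRing.Theory.
Local Open Scope ring_scope.

Local Obligation Tactic := idtac.

(** * Isomorphic objects under functors and equivalences *)

Section Isomorphisms.

Lemma isomorphic_sym (C : category) (X Y : C) :
  isomorphic X Y -> isomorphic Y X.
Proof. by case=> f [g [gf fg]]; exists g, f. Qed.

Lemma isomorphic_trans (C : category) (X Y Z : C) :
  isomorphic X Y -> isomorphic Y Z -> isomorphic X Z.
Proof.
case=> f [g [gf fg]] [f' [g' [gf' fg']]]; exists (f' \oc f), (g \oc g').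
split; first by rewrite -compA (compA _ _ f) gf' comp_idl.
by rewrite -compA (compA _ _ g') fg comp_idl.
Qed.

Lemma fmap_isomorphic (C D : category) (F : functor C D) (X Y : C) :
  isomorphic X Y -> isomorphic (F X) (F Y).
Proof.
case=> f [g [gf fg]]; exists (fmap F f), (fmap F g).
by rewrite -!fmap_comp gf fg !fmap_idm.
Qed.

Lemma nat_isomorphic (C D : category) (F G : functor C D) (X : C) :
  isomorphic (C := functor_cat C D) F G -> isomorphic (F X) (G X).
Proof.
case=> s [t [ts st]]; exists (s X), (t X).
by split; [have := congr1 (fun u : nat_trans F F => u X) ts
          | have := congr1 (fun u : nat_trans G G => u X) st].
Qed.

Lemma equivalence_reflects_isomorphic (C D : category) (F : functor C D)
    (X Y : C) :
  is_equivalence F -> isomorphic (F X) (F Y) -> isomorphic X Y.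
Proof.
case=> G [GF _] /(fmap_isomorphic G) FXY.
apply: isomorphic_trans (isomorphic_sym (nat_isomorphic X GF)) _.
exact: isomorphic_trans FXY (nat_isomorphic Y GF).
Qed.

End Isomorphisms.

(** * Kernels and monomorphisms in a linear category *)

Section LinearComposition.
Variables (R : comPzRingType) (A : lincat R).

Lemma compDl (X Y Z : A) (g h : hom Y Z) (f : hom X Y) :
  (g + h) \oc f = g \oc f + h \oc f.
Proof. by have := comp_linl f 1 g h; rewrite /= !scale1r. Qed.

Lemma compDr (X Y Z : A) (g : hom Y Z) (f h : hom X Y) :
  g \oc (f + h) = g \oc f + g \oc h.
Proof. by have := comp_linr g 1 f h; rewrite /= !scale1r. Qed.

Lemma comp0l (X Y Z : A) (f : hom X Y) : (0 : hom Y Z) \oc f = 0.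
Proof. by apply: (addrI (0 \oc f)); rewrite -compDl !addr0. Qed.

Lemma comp0r (X Y Z : A) (g : hom Y Z) : g \oc (0 : hom X Y) = 0.
Proof. by apply: (addrI (g \oc 0)); rewrite -compDr !addr0. Qed.

Lemma compBr (X Y Z : A) (g : hom Y Z) (f h : hom X Y) :
  g \oc (f - h) = g \oc f - g \oc h.
Proof. by apply: (addIr (g \oc h)); rewrite -compDr !subrK. Qed.

Lemma mono_comp0 (X Y : A) (f : hom X Y) :
  mono f <-> forall W (u : hom W X), f \oc u = 0 -> u = 0.
Proof.
split=> [fm W u fu|fm W u v fuv]; first by apply: fm; rewrite comp0r.
by apply/subr0_eq/fm; rewrite compBr fuv subrr.
Qed.

Lemma is_kernel_mono (X Y K : A) (f : hom X Y) (k : hom K X) :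
  is_kernel f k -> mono k.
Proof.
case=> fk kf W u v kuv.
have [w [_ w_uniq]] : exists! w : hom W K, k \oc w = k \oc u.
  by apply: kf; rewrite compA fk comp0l.
by rewrite -(w_uniq u) // (w_uniq v).
Qed.

Lemma is_kernel_lift (X Y K W : A) (f : hom X Y) (k : hom K X) (g : hom W X) :
  is_kernel f k -> f \oc g = 0 -> exists u : hom W K, k \oc u = g.
Proof. by case=> _ kf /kf[u [ku _]]; exists u. Qed.

Lemma is_kernelI (X Y K : A) (f : hom X Y) (k : hom K X) :
  mono k -> f \oc k = 0 ->
  (forall W (g : hom W X), f \oc g = 0 -> exists u : hom W K, k \oc u = g) ->
  is_kernel f k.
Proof.
move=> km fk kf; split=> // W g /kf[u ku].
by exists u; split=> // v kv; apply: km; rewrite ku kv.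
Qed.

Lemma mono_comp (X Y Z : A) (g : hom Y Z) (f : hom X Y) :
  mono g -> mono f -> mono (g \oc f).
Proof. by move=> gm fm W u v; rewrite -!compA => /gm/fm. Qed.

Lemma mono_of_comp (X Y Z : A) (g : hom Y Z) (f : hom X Y) :
  mono (g \oc f) -> mono f.
Proof.
by move=> gfm W u v fuv; apply: gfm; rewrite -!compA fuv.
Qed.

Lemma mono_idm (X : A) : mono (idm X).
Proof. by move=> W u v; rewrite !comp_idl. Qed.

End LinearComposition.

(** * Duality in linear categories *)

Definition op_category (C : category) : category :=
  @Category C (fun X Y => hom Y X) (fun X => idm X) (fun X Y Z g f => f \oc g)
    (fun X Y f => comp_idr f) (fun X Y f => comp_idl f)
    (fun X Y Z W h g f => esym (compA f g h)).

(** Kernels, monomorphisms and biproducts of the opposite unfold to cokernels, epimorphisms and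
    biproducts of [A], so dual statements follow by conversion. *)
Definition op_lincat (R : comPzRingType) (A : lincat R) : lincat R :=
  @LinCat R (op_category A) (fun X Y => hom_lmod Y X)
    (fun X Y Z f => comp_linr (f : hom (Y : A) X))
    (fun X Y Z g => comp_linl (g : hom (Z : A) Y)).

Section Duality.
Variables (R : comPzRingType) (A : lincat R).

Lemma op_abelian : is_abelian A -> is_abelian (op_lincat A).
Proof.
case=> z b k c m e; split.
- exact: z.
- move=> X Y; have [P [i1 [i2 [p1 [p2 [h1 h2 h3 h4 h5]]]]]] := b X Y.
  by exists P, p1, p2, i1, i2; split.
- by move=> X Y f; have [Q [q qP]] := c _ _ f; exists Q, q.
- by move=> X Y f; have [Q [q qP]] := k _ _ f; exists Q, q.
- by move=> X Y f /(e _ _ f).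
- by move=> X Y f /(m _ _ f).
Qed.

Lemma epi_comp0 (X Y : A) (f : hom X Y) :
  epi f <-> forall W (u : hom Y W), u \oc f = 0 -> u = 0.
Proof. exact: (@mono_comp0 _ (op_lincat A) Y X f). Qed.

Lemma is_cokernel_epi (X Y Q : A) (f : hom X Y) (q : hom Y Q) :
  is_cokernel f q -> epi q.
Proof. exact: (@is_kernel_mono _ (op_lincat A) Y X Q f q). Qed.

Lemma is_cokernel_desc (X Y Q W : A) (f : hom X Y) (q : hom Y Q)
    (g : hom Y W) :
  is_cokernel f q -> g \oc f = 0 -> exists u : hom Q W, u \oc q = g.
Proof. exact: (@is_kernel_lift _ (op_lincat A) Y X Q W f q g). Qed.

Lemma epi_comp (X Y Z : A) (g : hom Y Z) (f : hom X Y) :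
  epi g -> epi f -> epi (g \oc f).
Proof.
by move=> ge fe; apply: (@mono_comp _ (op_lincat A) Z Y X f g).
Qed.

Lemma epi_idm (X : A) : epi (idm X).
Proof. exact: (@mono_idm _ (op_lincat A)). Qed.

End Duality.

(** * Images and exactness in an abelian category *)

Section AbelianCategory.
Variables (R : comPzRingType) (A : lincat R) (A_abelian : is_abelian A).

(** [m] is the kernel of some [f]; this [f] factors through [q], so it kills whatever [q] kills. *)
Lemma mono_kernel_coker (X Y Q : A) (m : hom X Y) (q : hom Y Q) :
  mono m -> is_cokernel m q -> is_kernel q m.
Proof.
move=> mm mq; have [Z [f fm]] := mono_normal A_abelian mm.
apply: is_kernelI => //; first exact: mq.1.
move=> W g qg; apply: (is_kernel_lift fm).
have [f' <-] := is_cokernel_desc mq fm.1.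
by rewrite -compA qg comp0r.
Qed.

(** [n \oc mu] is the kernel of some [h], which then kills [n] as well; so [n] factors through
    [n \oc mu], and cancelling [n] leaves a section of [mu]. *)
Lemma mono_split_epi (X Y Z : A) (n : hom Y Z) (mu : hom X Y) :
  mono n -> mono mu ->
  (forall W (h : hom Z W), h \oc (n \oc mu) = 0 -> h \oc n = 0) ->
  exists s, mu \oc s = idm Y.
Proof.
move=> nm mum hn.
have [W [h hP]] := mono_normal A_abelian (mono_comp nm mum).
have [s sP] := is_kernel_lift hP (hn _ _ hP.1).
by exists s; apply: nm; rewrite comp_idr compA.
Qed.

Lemma image_factorization (X Y : A) (f : hom X Y) :
  exists I (m : hom I Y) (e : hom X I), [/\ mono m, epi e & m \oc e = f].
Proof.
have [Q [c cf]] := has_cokernels A_abelian f.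
have [I [m mc]] := has_kernels A_abelian c.
have [e em] := is_kernel_lift mc cf.1.
have mm := is_kernel_mono mc.
exists I, m, e; split=> //; apply/epi_comp0 => W v ve.
have [K [w wv]] := has_kernels A_abelian v.
have [e' e'w] := is_kernel_lift wv ve.
(* Since [f] is [m \oc w \oc e'], a morphism killing [m \oc w] kills [f], hence factors through [c],
   which kills [m]. So the kernel [w] of [v] has a section, and [v] vanishes. *)
have [|s ws] := mono_split_epi mm (is_kernel_mono wv).
  move=> V h hmw; have [|h' <-] := is_cokernel_desc (g := h) cf.
    by rewrite -em -e'w (compA m) compA hmw comp0l.
  by rewrite -compA mc.1 comp0r.
by rewrite -(comp_idr v) -ws compA wv.1 comp0l.
Qed.

(** The image [mu] of [e] satisfies the same hypothesis as [e], hence has a section; a morphism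
    killing [e] kills [mu] and so vanishes. *)
Lemma epi_of_comp_mono (X Y Z : A) (n : hom Y Z) (e : hom X Y) :
  mono n -> (forall W (h : hom Z W), h \oc (n \oc e) = 0 -> h \oc n = 0) ->
  epi e.
Proof.
move=> nm hn; have [I [mu [ep [mum epe mue]]]] := image_factorization e.
have [|s sP] := mono_split_epi nm mum.
  by move=> W h hnmu; apply: hn; rewrite -mue (compA n) compA hnmu comp0l.
apply/epi_comp0 => W v; rewrite -mue compA -(comp0l _ ep) => /epe vmu.
by rewrite -(comp_idr v) -sP compA vmu comp0l.
Qed.

(** The condition says that the composite of the kernel of [g] with the cokernel of [f] is zero.
    This form is self-dual and mentions no image, which turns exactness into a matter of
    equations. *)
Lemma exactP (X Y Z : A) (f : hom X Y) (g : hom Y Z) :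
  exact f g <-> g \oc f = 0 /\
    forall W V (u : hom W Y) (v : hom Y V),
      g \oc u = 0 -> v \oc f = 0 -> v \oc u = 0.
Proof.
split.
  case=> I [m [[Q [q [fq qm]]] gm]]; split.
    by have [f' <-] := is_kernel_lift qm fq.1; rewrite compA gm.1 comp0l.
  move=> W V u v /(is_kernel_lift gm)[u' <-] /(is_cokernel_desc fq)[v' <-].
  by rewrite compA -(compA v') qm.1 comp0r comp0l.
case=> gf uv; have [Q [q fq]] := has_cokernels A_abelian f.
have [I [m qm]] := has_kernels A_abelian q.
exists I, m; split; first by exists Q, q.
apply: is_kernelI (is_kernel_mono qm) _ _.
  by have [g' <-] := is_cokernel_desc fq gf; rewrite -compA qm.1 comp0r.
by move=> W u gu; apply: is_kernel_lift qm _; apply: uv => //; apply: fq.1.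
Qed.

Lemma mono_exact_kernel (X Y Z : A) (f : hom X Y) (g : hom Y Z) :
  mono f -> exact f g -> is_kernel g f.
Proof.
move=> fm /exactP[gf fg]; have [Q [q fq]] := has_cokernels A_abelian f.
apply: is_kernelI => // W u gu.
apply: is_kernel_lift (mono_kernel_coker fm fq) _.
by apply: fg => //; apply: fq.1.
Qed.

End AbelianCategory.

(** * Extensions and subquotients in an abelian category *)

Section AbelianDuality.
Variables (R : comPzRingType) (A : lincat R) (A_abelian : is_abelian A).

Lemma epi_cokernel_ker (X Y K : A) (e : hom X Y) (k : hom K X) :
  epi e -> is_kernel e k -> is_cokernel k e.
Proof.
exact: (@mono_kernel_coker _ _ (op_abelian A_abelian) Y X K e k).
Qed.

Lemma mono_of_epi_comp (X Y Z : A) (m : hom Y Z) (q : hom X Y) :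
  epi q -> (forall W (h : hom W X), (m \oc q) \oc h = 0 -> q \oc h = 0) ->
  mono m.
Proof.
exact: (@epi_of_comp_mono _ _ (op_abelian A_abelian) Z Y X q m).
Qed.

Lemma exact_op (X Y Z : A) (f : hom X Y) (g : hom Y Z) :
  exact f g -> @exact _ (op_lincat A) Z Y X g f.
Proof.
move=> /(exactP A_abelian)[gf uv].
apply/(exactP (op_abelian A_abelian)); split=> // W V u v fu vg.
exact: uv vg fu.
Qed.

Lemma epi_exact_cokernel (X Y Z : A) (f : hom X Y) (g : hom Y Z) :
  epi g -> exact f g -> is_cokernel f g.
Proof.
move=> ge /exact_op.
exact: (@mono_exact_kernel _ _ (op_abelian A_abelian) Z Y X g f).
Qed.

(** In a five-term exact sequence, [b] induces a monomorphism from the cokernel of [a], and [d] an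
    epimorphism onto the kernel of [c]; these two inherit exactness at the middle term [E]. *)
Lemma exact_extension (X1 X2 E X3 X4 K L : A) (a : hom X1 X2) (b : hom X2 E)
    (d : hom E X3) (c : hom X3 X4) (q : hom X2 K) (l : hom L X3) :
  exact a b -> exact b d -> exact d c -> is_cokernel a q -> is_kernel c l ->
  is_extension K L E.
Proof.
move=> /(exactP A_abelian)[ba ab] /(exactP A_abelian)[db bd].
move=> /(exactP A_abelian)[cd dc] aq cl.
have [k kb] := is_cokernel_desc aq ba.
have [p pd] := is_kernel_lift cl cd.
have km : mono k.
  apply: (mono_of_epi_comp (is_cokernel_epi aq)) => W h; rewrite kb => bh.
  by apply: ab => //; apply: aq.1.
have pe : epi p.
  apply: (epi_of_comp_mono A_abelian (is_kernel_mono cl)) => W h.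
  by rewrite pd => hd; apply: dc => //; apply: cl.1.
have kp : exact k p.
  apply/(exactP A_abelian); split.
    apply: (is_kernel_mono cl); apply: (is_cokernel_epi aq).
    by rewrite -!compA kb compA pd db comp0l comp0r.
  move=> W V u v pu vk; apply: bd; first by rewrite -pd -compA pu comp0r.
  by rewrite -kb compA vk comp0l.
exists k, p; split; first exact: mono_exact_kernel.
exact: epi_exact_cokernel.
Qed.

Lemma biproduct_extension (X Y P : A) :
  is_biproduct X Y P -> is_extension X Y P.
Proof.
case=> i1 [i2 [p1 [p2 [p11 p22 p12 p21 ip]]]].
have i1m : mono i1.
  by apply: (@mono_of_comp _ _ _ _ _ p1); rewrite p11; apply: mono_idm.
have p2e : epi p2.
  by apply: (@mono_of_comp _ (op_lincat A) _ _ _ i2 p2); rewrite /= p22;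
    apply: epi_idm.
have ex : exact i1 p2.
  apply/(exactP A_abelian); split=> // W V u v pu vi.
  (* As [p2] kills [u], the decomposition of the identity gives [u] as [i1 \oc p1 \oc u], and [v]
     kills [i1]. *)
  rewrite -(comp_idl u) -ip compDl compDr -!compA pu !comp0r addr0.
  by rewrite !compA vi !comp0l.
exists i1, p2; split; first exact: mono_exact_kernel.
exact: epi_exact_cokernel.
Qed.

(** [N'] is the preimage of [Q'] under [e], built as the kernel of [c \oc e] with [c] a cokernel of
    [n]. *)
Lemma subobject_of_quotient (N Q Q' : A) (e : hom N Q) (n : hom Q' Q) :
  epi e -> mono n ->
  exists N' (w : hom N' N) (e' : hom N' Q'),
    [/\ mono w, epi e' & e \oc w = n \oc e'].
Proof.
move=> ee nm; have [C [c nc]] := has_cokernels A_abelian n.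
have cn := mono_kernel_coker A_abelian nm nc.
have [N' [w wP]] := has_kernels A_abelian (c \oc e).
have [|e' e'P] := is_kernel_lift (g := e \oc w) cn.
  by rewrite compA wP.1.
exists N', w, e'; split; [exact: is_kernel_mono wP| |by []].
apply: (epi_of_comp_mono A_abelian nm) => W t; rewrite e'P compA => tew.
(* The epimorphism [c \oc e] is the cokernel of its kernel [w], so a [t] with [t \oc e \oc w] zero
   factors through [c] and kills [n]. *)
have ce := epi_cokernel_ker (epi_comp (is_cokernel_epi nc) ee) wP.
have [t' t'P] := is_cokernel_desc ce tew.
have -> : t = t' \oc c by apply: ee; rewrite -compA.
by rewrite -compA nc.1 comp0r.
Qed.

End AbelianDuality.

(** * Closure of subquotients and iterated extensions under subobjects and quotients *)

Section ClosureProperties.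
Variables (R : comPzRingType) (A : lincat R) (A_abelian : is_abelian A).

Definition sub_closed (P : A -> Prop) : Prop :=
  forall (X Y : A) (m : hom X Y), mono m -> P Y -> P X.

Definition quotient_closed (P : A -> Prop) : Prop :=
  forall (X Y : A) (e : hom X Y), epi e -> P X -> P Y.

Lemma iterated_extension_sub (P : A -> Prop) :
  sub_closed P -> sub_closed (iterated_extension P).
Proof.
move=> Psub X Y m + PY; elim: PY X m => {Y} [Y PY|K L E _ IHK _ IHL].
  by move=> X m mm; apply: iext_base; apply: (Psub _ _ _ mm PY).
move=> [f [g [gf fg]]] X m mm.
(* The subobject [X] of [E] is an extension of its image [L'] in [L] by the kernel [K'] of
   [X -> L'], and [K'] embeds in [K]; induction applies to both. *)
have [L' [l [p [lm pe lp]]]] := image_factorization A_abelian (g \oc m).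
have [K' [k pk]] := has_kernels A_abelian p.
have [|k' fk'] := is_kernel_lift (g := m \oc k) gf.
  by rewrite compA -lp -compA pk.1 comp0r.
apply: (@iext_step _ _ _ K' L'); last 2 first.
- exact: IHL lm.
- by exists k, p; split=> //; apply: epi_cokernel_ker.
apply: (IHK _ k'); apply: (@mono_of_comp _ _ _ _ _ f); rewrite fk'.
exact: mono_comp mm (is_kernel_mono pk).
Qed.

Lemma abs_subquotient_sub (C : category) (D : subcategory C)
    (O : initial_object C) (O_dist : forall X, sub_mor D (from_init O X))
    (H : relhom D A) : sub_closed (abs_subquotient O_dist H).
Proof.
move=> Q' Q n nm [i [X [N [m [e [mm ee]]]]]].
have [N' [w [e' [wm ee' _]]]] := subobject_of_quotient A_abelian ee nm.
by exists i, X, N', (m \oc w), e'; split=> //; apply: mono_comp.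
Qed.

Lemma abs_subquotient_quotient (C : category) (D : subcategory C)
    (O : initial_object C) (O_dist : forall X, sub_mor D (from_init O X))
    (H : relhom D A) : quotient_closed (abs_subquotient O_dist H).
Proof.
move=> Q Q' q qe [i [X [N [m [e [mm ee]]]]]].
by exists i, X, N, m, (q \oc e); split=> //; apply: epi_comp.
Qed.

End ClosureProperties.

(** Reversing arrows swaps the subobject and the quotient of each extension. *)
Lemma iterated_extension_op (R : comPzRingType) (A : lincat R) (P : A -> Prop)
    (X : A) :
  iterated_extension P X -> @iterated_extension R (op_lincat A) P X.
Proof.
elim=> {X} [X PX|K L E _ IHK _ IHL [f [g [gf fg]]]]; first exact: iext_base.
by apply: (@iext_step _ (op_lincat A) _ L K) => //; exists g, f.
Qed.

Lemma op_iterated_extension (R : comPzRingType) (A : lincat R) (P : A -> Prop)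
    (X : A) :
  @iterated_extension R (op_lincat A) P X -> iterated_extension P X.
Proof.
elim=> {X} [X PX|K L E _ IHK _ IHL [f [g [gf fg]]]]; first exact: iext_base.
by apply: (@iext_step _ A _ L K) => //; exists g, f.
Qed.

Lemma iterated_extension_quotient (R : comPzRingType) (A : lincat R)
    (A_abelian : is_abelian A) (P : A -> Prop) :
  quotient_closed P -> quotient_closed (iterated_extension P).
Proof.
move=> Pquo X Y e ee /iterated_extension_op PX; apply: op_iterated_extension.
apply: (iterated_extension_sub (op_abelian A_abelian) _ ee PX).
by move=> X' Y' m mm PY'; apply: (Pquo _ _ _ mm PY').
Qed.

(** * Kernels and exactness in full subcategories *)

Section FullSubcategory.
Variables (R : comPzRingType) (A : lincat R).

Definition in_sub (S : A -> Prop) (X : A) (SX : S X) : full_sublincat S :=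
  exist S X SX.

Variable S : A -> Prop.
Local Notation B := (full_sublincat S).

Lemma in_sub_kernel (X Y : B) (f : hom X Y) (K : A) (k : hom K (sval X))
    (SK : S K) :
  is_kernel (f : hom (sval X) (sval Y)) k ->
  @is_kernel _ B X Y (in_sub SK) f k.
Proof. by case=> fk kf; split=> // W g fg; apply: kf. Qed.

(** By [exactP], exactness in the subcategory only tests against objects of [S], a part of the tests
    made in [A]. *)
Lemma full_sub_exact (B_abelian : is_abelian B) (A_abelian : is_abelian A)
    (X Y Z : B) (f : hom X Y) (g : hom Y Z) :
  @exact _ A (sval X) (sval Y) (sval Z) f g -> exact f g.
Proof.
move=> /(exactP A_abelian)[gf uv]; apply/(exactP B_abelian); split=> //.
by move=> W V u v; apply: uv.
Qed.

End FullSubcategory.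

(** * Full subcategories closed under subobjects and quotients *)

Section SerreSubcategory.
Variables (R : comPzRingType) (A : lincat R) (A_abelian : is_abelian A).
Variable S : A -> Prop.
Hypotheses (S_sub : sub_closed S) (S_quotient : quotient_closed S).
Local Notation B := (full_sublincat S).

(** The kernel of [m] in [A] lies in [S] as a subobject of [X], so it is a legitimate test object
    and the monomorphism condition in [S] makes it vanish. *)
Lemma serre_mono (X Y : B) (m : hom X Y) :
  mono m -> @mono A (sval X) (sval Y) m.
Proof.
move=> mm; have [K [k mk]] := @has_kernels _ _ A_abelian (sval X) (sval Y) m.
have SK : S K by apply: (S_sub (is_kernel_mono mk) (svalP X)).
have k0 : k = 0.
  by apply: ((@mono_comp0 _ B X Y m).1 mm (in_sub SK)); apply: mk.1.
apply/(@mono_comp0 _ A (sval X) (sval Y) m) => W u.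
by move=> /(is_kernel_lift mk)[u' <-]; rewrite k0 comp0l.
Qed.

Lemma serre_mono_normal (X Y : B) (m : hom X Y) :
  mono m -> exists Z (f : hom Y Z), is_kernel f m.
Proof.
move=> /serre_mono mm.
have [Q [q mq]] := @has_cokernels _ _ A_abelian (sval X) (sval Y) m.
have SQ : S Q by apply: (S_quotient (is_cokernel_epi mq) (svalP Y)).
have [qm mker] := mono_kernel_coker A_abelian mm mq.
by exists (in_sub SQ), q; split=> // W g; apply: mker.
Qed.

Lemma serre_kernels (X Y : B) (f : hom X Y) :
  exists K (k : hom K X), is_kernel f k.
Proof.
have [K [k fk]] := @has_kernels _ _ A_abelian (sval X) (sval Y) f.
have SK : S K by apply: (S_sub (is_kernel_mono fk) (svalP X)).
by exists (in_sub SK), k; apply: in_sub_kernel.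
Qed.

End SerreSubcategory.

Lemma serre_abelian (R : comPzRingType) (A : lincat R)
    (A_abelian : is_abelian A) (S : A -> Prop) :
  (exists X, S X) -> sub_closed S -> quotient_closed S ->
  (forall X Y P, is_biproduct X Y P -> S X -> S Y -> S P) ->
  is_abelian (full_sublincat S).
Proof.
move=> [X0 SX0] S_sub S_quo S_bi.
(* Duality exchanges the two closure conditions, so the half about kernels and monomorphisms,
   applied to the opposite, yields the half about cokernels and epimorphisms. *)
have Sop_sub : @sub_closed R (op_lincat A) S.
  by move=> X Y m mm; apply: (S_quo _ _ _ mm).
have Sop_quo : @quotient_closed R (op_lincat A) S.
  by move=> X Y m mm; apply: (S_sub _ _ _ mm).
have opA := op_abelian A_abelian; split.
- have [Z Z0] := has_zero_object A_abelian.
  have SZ : S Z.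
    apply: (S_sub _ _ (0 : hom Z X0) _ SX0); apply/mono_comp0 => W u _.
    by rewrite -(comp_idl u) Z0 comp0l.
  by exists (in_sub SZ).
- move=> X Y; have [P XYP] := has_biproducts A_abelian (sval X) (sval Y).
  by exists (in_sub (S_bi _ _ _ XYP (svalP X) (svalP Y))).
- exact: serre_kernels.
- by move=> X Y f; apply: (serre_kernels opA Sop_sub (X := Y) (Y := X) f).
- exact: serre_mono_normal.
- move=> X Y f.
  exact: (serre_mono_normal opA Sop_sub Sop_quo (X := Y) (Y := X) (m := f)).
Qed.

Lemma serre_abelian_subcategory (R : comPzRingType) (A : lincat R)
    (A_abelian : is_abelian A) (S : A -> Prop) :
  (exists X, S X) -> sub_closed S -> quotient_closed S ->
  (forall X Y P, is_biproduct X Y P -> S X -> S Y -> S P) ->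
  abelian_subcategory S.
Proof.
move=> S0 S_sub S_quo S_bi.
have B_abelian := serre_abelian A_abelian S0 S_sub S_quo S_bi.
split=> //.
  move=> X Y [f [g [gf fg]]]; apply: (S_sub _ _ g).
  by apply: (@mono_of_comp _ _ _ _ _ f); rewrite fg; apply: mono_idm.
split=> [X Y c u v //|X Y Z f g /(exactP B_abelian)[gf uv]].
apply/(exactP A_abelian); split=> // W V u v.
(* It suffices to test with the kernel of [g] and the cokernel of [f] taken in [A]: both lie in [S],
   and arbitrary [u], [v] factor through them. *)
have [K [k gk]] := @has_kernels _ _ A_abelian (sval Y) (sval Z) g.
have [Q [q fq]] := @has_cokernels _ _ A_abelian (sval X) (sval Y) f.
have SK : S K by apply: (S_sub _ _ _ (is_kernel_mono gk) (svalP Y)).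
have SQ : S Q by apply: (S_quo _ _ _ (is_cokernel_epi fq) (svalP Y)).
move=> /(is_kernel_lift gk)[u' <-] /(is_cokernel_desc fq)[v' <-].
rewrite compA -(compA v') [q \oc k](uv (in_sub SK) (in_sub SQ)).
- by rewrite comp0r comp0l.
- exact: gk.1.
- exact: fq.1.
Qed.

(** * Essential smallness of full subcategories *)

Lemma small_sig (T : Type) (P : T -> Prop) :
  small_type T -> small_type {x | P x}.
Proof.
case=> I [e [e' eK e'K]].
exists {i : I | P (e i)}, (fun i => exist P (e (sval i)) (svalP i)).
have Pe' (x : {x | P x}) : P (e (e' (sval x))) by rewrite e'K; apply: svalP.
exists (fun x => exist (fun i => P (e i)) (e' (sval x)) (Pe' x)).
  by case=> i Pi /=; apply: eq_exist; rewrite /= eK.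
by case=> x Px /=; apply: eq_exist; rewrite /= e'K.
Qed.

(** The small model of an essentially small linear category carries no linear structure, whereas
    [full_subcat] starts from a linear category. *)
Program Definition full_subcategory (C : category) (P : C -> Prop) : category :=
  @Category {X : C | P X} (fun X Y => hom (sval X) (sval Y))
    (fun X => idm (sval X)) (fun X Y Z g f => g \oc f) _ _ _.
Next Obligation. by move=> *; apply: comp_idl. Qed.
Next Obligation. by move=> *; apply: comp_idr. Qed.
Next Obligation. by move=> *; apply: compA. Qed.

(** The objects of the small model that [F] sends into [S] form a small model of the subcategory.
    Closure of [S] under isomorphism lets the quasi-inverse [G] restrict to it. *)
Lemma full_sublincat_small (R : comPzRingType) (A : lincat R) (S : A -> Prop) :
  (forall X Y, isomorphic X Y -> S X -> S Y) ->
  essentially_small A -> essentially_small (full_sublincat S).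
Proof.
move=> S_iso [D [D_small homD_small] [F [G [GF FG]]]].
have SFG (X : {X : A | S X}) : S (F (G (sval X))).
  apply: S_iso (svalP X); apply: isomorphic_sym.
  exact: (nat_isomorphic (sval X) FG).
have [s [s' [s's ss']]] := GF; have [t [t' [t't tt']]] := FG.
pose D' := full_subcategory (fun X => S (F X)).
exists D'; first by split; [apply: small_sig|move=> X Y; apply: homD_small].
pose F' := @Functor D' (full_sublincat S)
  (fun X => in_sub (svalP X)) (fun X Y f => fmap F f)
  (fun X => fmap_idm F (sval X)) (fun X Y Z g f => fmap_comp F g f).
pose G' := @Functor (full_sublincat S) D'
  (fun X => exist _ (G (sval X)) (SFG X)) (fun X Y f => fmap G f)
  (fun X => fmap_idm G (sval X)) (fun X Y Z g f => fmap_comp G g f).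
have ncompE (P Q : category) (K L : functor P Q) (u v : nat_trans K L) X :
  u = v -> u X = v X by move=> ->.
exists F', G'; split.
  exists (@NatTrans _ _ (comp_functor G' F') (id_functor D')
    (fun X => s (sval X)) (fun X Y f => naturality s f)).
  exists (@NatTrans _ _ (id_functor D') (comp_functor G' F')
    (fun X => s' (sval X)) (fun X Y f => naturality s' f)).
  split; apply: nat_trans_eq => X.
    exact: (ncompE _ _ _ _ _ _ (sval X) s's).
  exact: (ncompE _ _ _ _ _ _ (sval X) ss').
exists (@NatTrans _ _ (comp_functor F' G') (id_functor (full_sublincat S))
  (fun X => t (sval X)) (fun X Y f => naturality t f)).
exists (@NatTrans _ _ (id_functor (full_sublincat S)) (comp_functor F' G')
  (fun X => t' (sval X)) (fun X Y f => naturality t' f)).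
split; apply: nat_trans_eq => X.
  exact: (ncompE _ _ _ _ _ _ (sval X) t't).
exact: (ncompE _ _ _ _ _ _ (sval X) tt').
Qed.

(** * Corestriction of a relative homology to a full subcategory *)

Section Corestriction.
Variables (R : comPzRingType) (C : category) (D : subcategory C).
Variables (A : lincat R) (A_abelian : is_abelian A) (S : A -> Prop).
Hypothesis S_abelian : is_abelian (full_sublincat S).
Variables (H : relhom D A) (SH : forall i P, S (H i P)).
Local Notation B := (full_sublincat S).

Definition corestrict_functor (P : category) (F : functor P A)
    (SF : forall X, S (F X)) : functor P B :=
  @Functor P B (fun X => in_sub (SF X)) (fun X Y f => fmap F f)
    (fun X => fmap_idm F X) (fun X Y Z g f => fmap_comp F g f).

Program Definition corestrict_relhom : relhom D B :=
  @RelHom C D R B (fun i => corestrict_functor (SH i))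
    (fun i t => rh_bd H i t) _ _ _ _.
Next Obligation.
by move=> i t; apply: full_sub_exact => //; apply: rh_exact_alpha_beta.
Qed.
Next Obligation.
by move=> i t; apply: full_sub_exact => //; apply: rh_exact_beta_bd.
Qed.
Next Obligation.
by move=> i t; apply: full_sub_exact => //; apply: rh_exact_bd_alpha.
Qed.
Next Obligation. by move=> i t t' gamma delta /(rh_cube H i). Qed.

End Corestriction.

(** * Exact functors and the consequence of universality *)

Lemma exact_functor_id (R : comPzRingType) (A : lincat R) :
  exact_functor (id_functor A).
Proof. by split. Qed.

Lemma exact_functor_comp (R : comPzRingType) (A B E : lincat R)
    (G : functor B E) (F : functor A B) :
  exact_functor G -> exact_functor F -> exact_functor (comp_functor G F).
Proof.
case=> Gl Ge [Fl Fe]; split=> [X Y a u v /=|X Y Z f g /Fe/Ge //].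
by rewrite Fl Gl.
Qed.

Lemma universal_relhom_generates (R : comPzRingType) (C : category)
    (D : subcategory C) (A : Ex R) (H : relhom D A) (S : A -> Prop) :
  universal H -> abelian_subcategory S -> (forall i P, S (H i P)) ->
  forall X, S X.
Proof.
move=> H_univ [S_iso S_abelian S_exact] SH X.
pose B := ExObj S_abelian (full_sublincat_small S_iso (ex_small A)).
pose K := corestrict_relhom (ex_abelian A) S_abelian SH.
(* [E] is a quasi-inverse of [precomp B H], so [E K] is an exact functor to [S] whose composite with
   [H] is isomorphic to [K]. *)
have [E [_ EB]] := H_univ B.
have [t [t' [t't tt']]] := nat_isomorphic (K : relhom_cat D B) EB.
pose G : exfun A A :=
  ExFun (exact_functor_comp S_exact (exfun_exact (E K))).
pose I : exfun A A := ExFun (exact_functor_id A).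
(* Morphisms of the full subcategory are morphisms of [A], so the components of [t] and [t'] serve
   again; only their packaging changes. *)
have GH_iso : isomorphic (precomp A H G) (precomp A H I).
  pose s i : nat_trans (relhom_push H G i) (relhom_push H I i) :=
    @NatTrans _ _ (relhom_push H G i) (relhom_push H I i)
      (fun P => t i P) (fun P Q f => naturality (t i) f).
  pose s' i : nat_trans (relhom_push H I i) (relhom_push H G i) :=
    @NatTrans _ _ (relhom_push H I i) (relhom_push H G i)
      (fun P => t' i P) (fun P Q f => naturality (t' i) f).
  exists (@RelHomMor _ _ _ A (relhom_push H G) (relhom_push H I) s (rm_bd t)).
  exists (@RelHomMor _ _ _ A (relhom_push H I) (relhom_push H G) s' (rm_bd t')).
  split; apply: relhom_mor_eq => i P.
    exact: (congr1 (fun u : relhom_mor _ _ => u i P) t't).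
  exact: (congr1 (fun u : relhom_mor _ _ => u i P) tt').
(* The equivalence [precomp A H] reflects isomorphism, so [G] is isomorphic to the identity and [X]
   to the object [E K X] of [S]. *)
have [u [u' [u'u uu']]] := equivalence_reflects_isomorphic (H_univ A) GH_iso.
apply: (S_iso _ _ _ (svalP (E K X))); exists (u X), (u' X); split.
  exact: (congr1 (fun v : nat_trans G G => v X) u'u).
exact: (congr1 (fun v : nat_trans I I => v X) uu').
Qed.

(** * Generation by the absolute homology objects *)

Section Generation.
Variables (R : comPzRingType) (C : category) (D : subcategory C).
Variables (O : initial_object C).
Variables (O_dist : forall X : C, sub_mor D (from_init O X)).
Variables (A : lincat R) (A_abelian : is_abelian A) (H : relhom D A).

(** The pair [tr_XZ t] met below equals an absolute pair only propositionally. Taking the pairs as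
    variables with equations allows substitution although the type of [f] depends on them. *)
Lemma ker_or_coker_pairs (i j : int) (X Y : C) (P Q : pairs D) (K : A)
    (f : hom (H i P) (H j Q)) :
  P = abs_pair O_dist X -> Q = abs_pair O_dist Y ->
  (exists k : hom K (H i P), is_kernel f k) \/
  (exists q : hom (H j Q) K, is_cokernel f q) ->
  ker_or_coker O_dist H K.
Proof. by move=> PX QY; subst P Q => fK; exists i, j, X, Y, f. Qed.

Lemma relhom_extension (i : int) (P : pairs D) :
  exists K L, [/\ ker_or_coker O_dist H K, ker_or_coker O_dist H L
    & is_extension K L (H i P)].
Proof.
case: P => X Y g g_dist.
(* The triple of [0 -> Y -> X], whose pairs are (X, Y), (X, 0) and (Y, 0). *)
pose t := Triple (O_dist Y) g_dist.
have XZ : tr_XZ t = abs_pair O_dist X.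
  (* Initiality identifies the underlying morphisms. The proof of distinguishedness is generalized
     first so that the rewriting stays well typed. *)
  rewrite /tr_XZ /abs_pair /=; move: (sub_comp _ _).
  rewrite (from_init_uniq (g \oc from_init O Y)) => d.
  by congr Pair; apply: Prop_irrelevance.
have [K [q aq]] := has_cokernels A_abelian (fmap (H i) (alpha t)).
have [L [l cl]] := has_kernels A_abelian (fmap (H (i - 1)) (alpha t)).
exists K, L; split.
- by apply: (ker_or_coker_pairs (f := fmap (H i) (alpha t)) _ XZ);
    [|right; exists q].
- by apply: (ker_or_coker_pairs (f := fmap (H (i - 1)) (alpha t)) _ XZ);
    [|left; exists l].
- exact: (exact_extension A_abelian (rh_exact_alpha_beta H i t)
    (rh_exact_beta_bd H i t) (rh_exact_bd_alpha H i t) aq cl).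
Qed.

Lemma abelian_subcategory_full : abelian_subcategory (fun _ : A => True).
Proof.
apply: (serre_abelian_subcategory A_abelian) => //.
by have [Z _] := has_zero_object A_abelian; exists Z.
Qed.

Lemma ker_or_coker_subquotient (K : A) :
  ker_or_coker O_dist H K -> abs_subquotient O_dist H K.
Proof.
case=> i [j [X [Y [f [[k fk]|[q fq]]]]]].
  exists i, X, K, k, (idm K).
  by split; [exact: is_kernel_mono fk|exact: epi_idm].
exists j, Y, (abs_hom O_dist H j Y), (idm _), q.
by split; [exact: mono_idm|exact: is_cokernel_epi fq].
Qed.

Lemma abelian_subcategory_iterated_extension :
  abelian_subcategory (iterated_extension (abs_subquotient O_dist H)).
Proof.
apply: (serre_abelian_subcategory A_abelian).
(* Any absolute homology object, as a subquotient of itself, witnesses nonemptiness. *)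
- exists (abs_hom O_dist H 0 O); apply: iext_base.
  exists 0, (O : C), (abs_hom O_dist H 0 O), (idm _), (idm _).
  by split; [exact: mono_idm|exact: epi_idm].
- exact/(iterated_extension_sub A_abelian)/abs_subquotient_sub.
- exact/(iterated_extension_quotient A_abelian)/abs_subquotient_quotient.
- move=> X Y P /(biproduct_extension A_abelian) XYP PX PY.
  exact: iext_step PX PY XYP.
Qed.

Lemma iterated_extension_contains :
  contains_ker_coker_ext O_dist H
    (iterated_extension (abs_subquotient O_dist H)).
Proof.
split=> [K /ker_or_coker_subquotient|K L E]; first exact: iext_base.
move=> /ker_or_coker_subquotient Kq /ker_or_coker_subquotient Lq.
exact: iext_step (iext_base Kq) (iext_base Lq).
Qed.

End Generation.

Theorem theorem3p3p1 (R : comPzRingType) (C : category)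
  (C_small : small_category C) (D : subcategory C) (O : initial_object C)
  (O_dist : forall X : C, sub_mor D (from_init O X))
  (A : Ex R) (H : relhom D A) (H_univ : universal H) :
  (exists S : A -> Prop,
     is_smallest
       (fun S' => abelian_subcategory S' /\ contains_ker_coker_ext O_dist H S')
       S
     /\ forall X : A, S X)
  /\ (forall X : A, iterated_extension (abs_subquotient O_dist H) X).
Proof.
have all_in S : abelian_subcategory S -> contains_ker_coker_ext O_dist H S ->
    forall X, S X.
  move=> S_abelian [_ S_ext]; apply: universal_relhom_generates => // i P.
  have [K [L [Kkc Lkc KLE]]] := relhom_extension O_dist (ex_abelian A) H i P.
  exact: S_ext Kkc Lkc KLE.
split; last first.
  apply: all_in; last exact: iterated_extension_contains.
  exact/abelian_subcategory_iterated_extension/ex_abelian.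
(* Every admissible [S] is everything by [all_in], and the whole category is itself admissible, so
   it is the smallest one. *)
exists (fun _ => True); split=> //; split.
  by split=> //; apply/abelian_subcategory_full/ex_abelian.
by move=> S [S_abelian S_contains] X _; apply: all_in.
Qed.
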